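(* Let $W_{\psi,\varphi}$ be a normal weighted composition operator on $H^2(\mathbb{D})$ where $\varphi$ has an interior fixed point $p\in\mathbb{D}$, i.e., $$\psi=\gamma\frac{K_p}{K_p\circ\varphi},\qquad \varphi=\alpha_p\circ(\delta\alpha_p),$$ where $\gamma,\delta$ are constants with $|\delta|\le1$. Then $W_{\psi,\varphi}$ is complex symmetric with conjugation $\mathcal{J}W_{k_q,\sigma}$, where $$q=\frac{p-\overline{p}}{p^2-1},\qquad k_q(z)=\frac{\sqrt{1-|q|^2}}{1-\overline{q}z},\qquad \sigma(z)=\lambda\frac{q-z}{1-\overline{q}z},$$ with $\lambda=\overline{q}/q$ if $q\neq0$, and $\lambda$ any unimodular constant if $q=0$.
   Context: $\mathbb{D}$ is the open unit disk in $\mathbb{C}$; $H^2(\mathbb{D})$ is the classical Hardy–Hilbert space on $\mathbb{D}$, with reproducing kernel $K_w(z)=1/(1-\overline{w}z)$ at $w\in\mathbb{D}$. For $p\in\mathbb{D}$, $\alpha_p(z)=\frac{p-z}{1-\overline{p}z}$. For $\psi$ holomorphic on $\mathbb{D}$ and $\varphi$ a holomorphic self-map of $\mathbb{D}$, the weighted composition operator is $W_{\psi,\varphi}f=\psi\cdot(f\circ\varphi)$. A conjugation on a complex Hilbert space is an anti-linear, isometric map $\mathcal{C}$ with $\mathcal{C}^2=I$. A bounded operator $T$ is complex symmetric with conjugation $\mathcal{C}$ if $\mathcal{C}T=T^*\mathcal{C}$. $\mathcal{J}$ is the conjugation on $H^2(\mathbb{D})$ given by $\mathcal{J}(\sum_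{n\ge0}a_nz^n)=\sum_{n\ge0}\overline{a_n}z^n$.
   Formalization: For q=0 with p real and nonzero, complex symmetry is proved only for λ=-1 (it fails for other unimodular λ, e.g. p=δ=1/2, γ=λ=1); that the map is a conjugation is proved for every unimodular λ. *)

(* Defs.v *)
From Stdlib Require Import Reals ClassicalEpsilon.
From Coquelicot Require Import Coquelicot.

Open Scope C_scope.

Definition in_disk (z : C) : Prop := (Cmod z < 1)%R.

(* Functions on the disk are represented by functions on C that are only ever
   evaluated on the disk; two of them are identified when they agree there. *)
Definition eq_disk (f g : C -> C) : Prop := forall z, in_disk z -> f z = g z.

Definition holomorphic_disk (f : C -> C) : Prop :=
  forall z, in_disk z -> @ex_derive C_AbsRing C_NormedModule f z.

Definition self_map_disk (phi : C -> C) : Prop :=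
  forall z, in_disk z -> in_disk (phi z).

(* Coquelicot's [Series] is real-valued; this is the sum of a convergent
   complex series. *)
Definition CSeries (a : nat -> C) : C :=
  (Series (fun n => Re (a n)), Series (fun n => Im (a n))).

Definition expansion (f : C -> C) (a : nat -> C) : Prop :=
  forall z, in_disk z -> @is_pseries C_AbsRing C_NormedModule a z (f z).

Definition hardy (f : C -> C) : Prop :=
  exists a, expansion f a /\ ex_series (fun n => Cmod (a n) ^ 2)%R.

(* The Taylor coefficients at 0; they are unique whenever an expansion exists. *)
Definition coef (f : C -> C) : nat -> C :=
  epsilon (inhabits (fun _ : nat => RtoC 0)) (expansion f).

Definition hinner (f g : C -> C) : C :=
  CSeries (fun n => coef f n * Cconj (coef g n)).

Definition hnorm (f : C -> C) : R :=
  sqrt (Series (fun n => Cmod (coef f n) ^ 2)%R).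

(* Only the restriction to [hardy] functions, up to [eq_disk], is meaningful. *)
Definition operator := (C -> C) -> (C -> C).

Definition preserves_hardy (T : operator) : Prop :=
  forall f, hardy f -> hardy (T f).

Definition bounded_operator (T : operator) : Prop :=
  preserves_hardy T /\
  (forall (a b : C) f g, hardy f -> hardy g ->
     eq_disk (T (fun z => a * f z + b * g z))
             (fun z => a * T f z + b * T g z)) /\
  (exists M : R, forall f, hardy f -> (hnorm (T f) <= M * hnorm f)%R).

Definition is_adjoint (T S : operator) : Prop :=
  bounded_operator S /\
  forall f g, hardy f -> hardy g -> hinner (T f) g = hinner f (S g).

Definition normal_operator (T : operator) : Prop :=
  bounded_operator T /\
  exists S, is_adjoint T S /\
    forall f, hardy f -> eq_disk (T (S f)) (S (T f)).

Definition is_conjugation (J : operator) : Prop :=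
  preserves_hardy J /\
  (forall (a b : C) f g, hardy f -> hardy g ->
     eq_disk (J (fun z => a * f z + b * g z))
             (fun z => Cconj a * J f z + Cconj b * J g z)) /\
  (forall f, hardy f -> hnorm (J f) = hnorm f) /\
  (forall f, hardy f -> eq_disk (J (J f)) f).

Definition complex_symmetric_with (T J : operator) : Prop :=
  bounded_operator T /\ is_conjugation J /\
  exists S, is_adjoint T S /\
    forall f, hardy f -> eq_disk (J (T f)) (S (J f)).

Definition wcomp (psi phi : C -> C) : operator :=
  fun f z => psi z * f (phi z).

Definition conjJ : operator :=
  fun f z => CSeries (fun n => Cconj (coef f n) * Cpow z n).

Definition kernel (w z : C) : C := / (1 - Cconj w * z).

Definition normalized_kernel (w z : C) : C :=
  RtoC (sqrt (1 - Cmod w ^ 2)) / (1 - Cconj w * z).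

Definition alpha (p z : C) : C := (p - z) / (1 - Cconj p * z).

(* Main.v *)
Require Import Defs.
From Stdlib Require Import Reals Lra Lia ClassicalEpsilon.
From Coquelicot Require Import Coquelicot.

(** Write [U f = k_q * (f o sigma)], so that the proposed conjugation is [conjJ o U],
    that is, [f |-> conj (k_q (conj z) * f (sigma (conj z)))].

    That it is a conjugation. Since [lambda * q = conj q], substituting the formula
    into itself gives back [f], so [conjJ o U] is an involution on functions
    ([automorphism_conj_involutive]). It is therefore enough to show that [U] maps
    the Hardy space into itself and does not increase the norm: an involution that
    is a contraction is isometric. The contraction property
    ([weighted_automorphism_expansion]) comes from conjugating the backward shift by
    [U]. There is an explicit sequence transform [a |-> a'] such that, for [f] and
    [f'] with coefficients [a] and [a'],
    [U f (z) = b_0 + z * U f' (z)] and [|b_0|^2 + |a'|^2 <= |a|^2]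
    ([transported_shift_spec], [transported_shift_energy_le]). Iterating it produces
    the Taylor coefficients [b_0, b_1, ...] of [U f] one at a time; the remainder
    after [m] steps is [z^m * U f_m (z)] with [f_m] of norm at most that of [f], hence
    tends to 0, and the energy spent on the coefficients never exceeds [|a|^2].

    The intertwining relation. The adjoint [S] supplied by normality is computed from
    the reproducing kernels: [S g (z)] is the conjugate of [<T K_z, g>], and
    [T K_z] is a multiple of a kernel [K_v] because [T] is, up to the factor [gamma],
    a dilation conjugated by the self-adjoint unitary of [alpha_p]
    ([elliptic_wcomp_kernel], [adjoint_eval]). What remains is an identity between
    Moebius maps. The number [q] is chosen so that [sigma] maps [conj p] to [p]; then
    [alpha_p o sigma = mu * alpha_(conj p)] for a constant [mu]
    ([alpha_automorphism]), and the factor [mu] commutes with the dilation by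
    [delta]. For [q = 0] and [p <> 0] the condition that [sigma] maps [conj p = p] to
    [p] forces [lambda = -1]; for [p = 0] it holds for every [lambda]. *)

Open Scope C_scope.

(** * Complex series *)

Notation is_Cseries := (@is_series C_AbsRing C_NormedModule).

Lemma sum_n_Re (a : nat -> C) (n : nat) :
  Re (@sum_n C_AbelianMonoid a n) = sum_n (fun k => Re (a k)) n.
Proof.
  induction n as [|n IH].
  - now rewrite !sum_O.
  - rewrite !sum_Sn, <- IH. reflexivity.
Qed.

Lemma sum_n_Im (a : nat -> C) (n : nat) :
  Im (@sum_n C_AbelianMonoid a n) = sum_n (fun k => Im (a k)) n.
Proof.
  induction n as [|n IH].
  - now rewrite !sum_O.
  - rewrite !sum_Sn, <- IH. reflexivity.
Qed.

Lemma is_Cseries_components (a : nat -> C) (l : C) :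
  is_Cseries a l <->
  is_series (fun n => Re (a n)) (Re l) /\ is_series (fun n => Im (a n)) (Im l).
Proof.
  unfold is_series. split.
  - intros H. split; apply filterlim_locally; intros eps;
      generalize (proj1 (filterlim_locally _ _) H eps); apply filter_imp;
      intros n [Hr Hi].
    + rewrite <- sum_n_Re. exact Hr.
    + rewrite <- sum_n_Im. exact Hi.
  - intros [Hr Hi]. apply filterlim_locally; intros eps.
    generalize (filter_and _ _ (proj1 (filterlim_locally _ _) Hr eps)
                               (proj1 (filterlim_locally _ _) Hi eps)).
    apply filter_imp. intros n [H1 H2].
    rewrite <- sum_n_Re in H1. rewrite <- sum_n_Im in H2.
    split; assumption.
Qed.

Lemma CSeries_unique (a : nat -> C) (l : C) : is_Cseries a l -> CSeries a = l.
Proof.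
  intros H. apply is_Cseries_components in H as [Hr Hi].
  unfold CSeries. rewrite (is_series_unique _ _ Hr), (is_series_unique _ _ Hi).
  now destruct l.
Qed.

Lemma is_Cseries_unique (a : nat -> C) (l l' : C) :
  is_Cseries a l -> is_Cseries a l' -> l = l'.
Proof.
  intros H H'. now rewrite <- (CSeries_unique _ _ H), (CSeries_unique _ _ H').
Qed.

Lemma is_Cseries_conj (a : nat -> C) (l : C) :
  is_Cseries a l -> is_Cseries (fun n => Cconj (a n)) (Cconj l).
Proof.
  intros H. apply is_Cseries_components in H as [Hr Hi].
  apply is_Cseries_components. split.
  - rewrite re_conj.
    apply is_series_ext with (2 := Hr). intros n. now rewrite re_conj.
  - rewrite im_conj.
    apply is_series_ext with (fun n => opp (Im (a n))).
    + intros n. now rewrite im_conj.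
    + now apply (is_series_opp (fun n => Im (a n))).
Qed.

Lemma is_Cseries_ext (a b : nat -> C) (l : C) :
  (forall n, a n = b n) -> is_Cseries a l -> is_Cseries b l.
Proof. exact (is_series_ext a b l). Qed.

Lemma is_Cseries_scal (c : C) (a : nat -> C) (l : C) :
  is_Cseries a l -> is_Cseries (fun n => c * a n) (c * l).
Proof. exact (is_series_scal c a l). Qed.

Lemma is_Cseries_plus (a b : nat -> C) (l m : C) :
  is_Cseries a l -> is_Cseries b m -> is_Cseries (fun n => a n + b n) (l + m).
Proof. exact (is_series_plus a b l m). Qed.

Lemma is_Cseries_tail (a : nat -> C) (l : C) :
  is_Cseries a l -> is_Cseries (fun n => a (S n)) (l - a O).
Proof.
  intros H. apply is_series_incr_1.
  change (is_Cseries a (l - a O + a O)).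
  now replace (l - a O + a O) with l by ring.
Qed.

Lemma Cmod_sum_n_le (a : nat -> C) (b : nat -> R) :
  (forall n, (Cmod (a n) <= b n)%R) ->
  forall n, (Cmod (@sum_n C_AbelianMonoid a n) <= sum_n b n)%R.
Proof.
  intros Hab n. induction n as [|n IH].
  - rewrite !sum_O. apply Hab.
  - rewrite !sum_Sn.
    apply Rle_trans with (1 := Cmod_triangle _ _).
    apply Rplus_le_compat; [exact IH|apply Hab].
Qed.

Lemma is_Cseries_lim_Cmod (a : nat -> C) (l : C) :
  is_Cseries a l ->
  is_lim_seq (fun n => Cmod (@sum_n C_AbelianMonoid a n)) (Cmod l).
Proof.
  intros H.
  exact (filterlim_comp _ _ _ _ _ _ _ _ H
           (@filterlim_norm C_AbsRing C_NormedModule l)).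
Qed.

Lemma is_Cseries_Cmod_le (a : nat -> C) (b : nat -> R) (l : C) (m : R) :
  (forall n, (Cmod (a n) <= b n)%R) ->
  is_Cseries a l -> is_series b m -> (Cmod l <= m)%R.
Proof.
  intros Hab Ha Hb.
  apply (is_lim_seq_le _ _ (Cmod l) m (Cmod_sum_n_le a b Hab)).
  - now apply is_Cseries_lim_Cmod.
  - exact Hb.
Qed.

Lemma im_le_Cmod (c : C) : (Rabs (Im c) <= Cmod c)%R.
Proof. apply Rle_trans with (2 := Rmax_Cmod c). apply Rmax_r. Qed.

Lemma is_Cseries_dominated (a : nat -> C) (b : nat -> R) :
  (forall n, (Cmod (a n) <= b n)%R) -> ex_series b -> is_Cseries a (CSeries a).
Proof.
  intros Hab Hb. apply is_Cseries_components. split; simpl; apply Series_correct.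
  - apply (@ex_series_le R_AbsRing R_CompleteNormedModule) with (2 := Hb).
    intros n. apply Rle_trans with (2 := Hab n). apply re_le_Cmod.
  - apply (@ex_series_le R_AbsRing R_CompleteNormedModule) with (2 := Hb).
    intros n. apply Rle_trans with (2 := Hab n). apply im_le_Cmod.
Qed.

Lemma is_Cseries_of_remainder (a : nat -> C) (l : C) (e : nat -> R) :
  (forall n, (Cmod (l - @sum_n C_AbelianMonoid a n) <= e n)%R) ->
  is_lim_seq e 0 -> is_Cseries a l.
Proof.
  intros He He0. apply is_Cseries_components.
  assert (H0 : forall (u : nat -> R) (x : R),
     (forall n, (Rabs (x - sum_n u n) <= e n)%R) -> is_series u x).
  { intros u x Hu. change (is_lim_seq (sum_n u) x).
    apply is_lim_seq_ext with (fun n => (x - (x - sum_n u n))%R).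
    { intros n. ring. }
    replace (Finite x) with (Rbar_plus x (Rbar_opp 0))
      by (simpl; f_equal; ring).
    apply is_lim_seq_minus'; [apply is_lim_seq_const|].
    apply is_lim_seq_abs_0.
    apply is_lim_seq_le_le with (fun _ => 0%R) e; auto.
    - intros n. split; [apply Rabs_pos|apply Hu].
    - apply is_lim_seq_const. }
  split; apply H0; intros n.
  - rewrite <- sum_n_Re. apply Rle_trans with (2 := He n).
    apply (re_le_Cmod (l - _)).
  - rewrite <- sum_n_Im. apply Rle_trans with (2 := He n).
    apply (im_le_Cmod (l - _)).
Qed.

(** * Power series on the disk *)

Lemma is_pseries_C (a : nat -> C) (z l : C) :
  @is_pseries C_AbsRing C_NormedModule a z l <->
  is_Cseries (fun n => a n * z ^ n) l.
Proof.
  assert (E : forall n, scal (@pow_n C_AbsRing z n) (a n : C_NormedModule)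
                        = a n * z ^ n).
  { intros n. assert (Ep : @pow_n C_AbsRing z n = z ^ n).
    { induction n as [|n IH]; [reflexivity|]. simpl. now rewrite IH. }
    rewrite Ep. change (z ^ n * a n = a n * z ^ n). ring. }
  unfold is_pseries. split; intros H; apply is_series_ext with (2 := H);
    intros n; [|symmetry]; apply E.
Qed.

(** The sum as a function of the coefficients, so that sequence transforms can be
    followed without naming the functions that they produce. *)
Definition psum (a : nat -> C) (z : C) : C := CSeries (fun n => a n * z ^ n).

Lemma is_series_geom_scal (M r : R) :
  (0 <= r < 1)%R -> is_series (fun n => (M * r ^ n)%R) (M / (1 - r))%R.
Proof.
  intros Hr.
  apply (@is_series_scal R_AbsRing R_NormedModule M (fun n => (r ^ n)%R)).
  apply is_series_geom. rewrite Rabs_pos_eq; lra.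
Qed.

Lemma Cmod_term_le (a : nat -> C) (M : R) (z : C) :
  (forall n, (Cmod (a n) <= M)%R) ->
  forall n, (Cmod (a n * z ^ n) <= M * Cmod z ^ n)%R.
Proof.
  intros HM n. rewrite Cmod_mult, Cmod_pow.
  apply Rmult_le_compat_r; [apply pow_le, Cmod_ge_0|apply HM].
Qed.

Lemma is_Cseries_psum (a : nat -> C) (M : R) (z : C) :
  (forall n, (Cmod (a n) <= M)%R) -> in_disk z ->
  is_Cseries (fun n => a n * z ^ n) (psum a z).
Proof.
  intros HM Hz. apply is_Cseries_dominated with (1 := Cmod_term_le a M z HM).
  eexists. apply is_series_geom_scal. split; [apply Cmod_ge_0|exact Hz].
Qed.

Lemma Cmod_psum_le (a : nat -> C) (M : R) (z : C) :
  (forall n, (Cmod (a n) <= M)%R) -> in_disk z ->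
  (Cmod (psum a z) <= M / (1 - Cmod z))%R.
Proof.
  intros HM Hz.
  apply is_Cseries_Cmod_le with (1 := Cmod_term_le a M z HM).
  - now apply is_Cseries_psum with M.
  - apply is_series_geom_scal. split; [apply Cmod_ge_0|exact Hz].
Qed.

Lemma psum_decr (a : nat -> C) (M : R) (z : C) :
  (forall n, (Cmod (a n) <= M)%R) -> in_disk z ->
  psum a z = a O + z * psum (fun n => a (S n)) z.
Proof.
  intros HM Hz.
  assert (H := is_Cseries_tail _ _ (is_Cseries_psum a M z HM Hz)).
  assert (H' : is_Cseries (fun n => z * (a (S n) * z ^ n))
                 (z * psum (fun n => a (S n)) z)).
  { apply is_Cseries_scal. apply is_Cseries_psum with M; auto. }
  assert (E : psum a z - a O * z ^ 0 = z * psum (fun n => a (S n)) z).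
  { apply is_Cseries_unique with (2 := H').
    apply is_Cseries_ext with (2 := H). intros n. simpl. ring. }
  simpl in E. rewrite <- E. ring.
Qed.

Lemma psum_lin (a b : nat -> C) (x y : C) (M : R) (z : C) :
  (forall n, (Cmod (a n) <= M)%R) -> (forall n, (Cmod (b n) <= M)%R) ->
  in_disk z ->
  psum (fun n => x * a n + y * b n) z = x * psum a z + y * psum b z.
Proof.
  intros Ha Hb Hz. apply CSeries_unique.
  apply is_Cseries_ext with (fun n => x * (a n * z ^ n) + y * (b n * z ^ n)).
  { intros n. ring. }
  apply is_Cseries_plus; apply is_Cseries_scal; now apply is_Cseries_psum with M.
Qed.

Lemma expansion_series (f : C -> C) (a : nat -> C) (z : C) :
  expansion f a -> in_disk z -> is_Cseries (fun n => a n * z ^ n) (f z).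
Proof. intros H Hz. now apply is_pseries_C, H. Qed.

Lemma in_disk_RtoC (x : R) : (Rabs x < 1)%R -> in_disk (RtoC x).
Proof. unfold in_disk. now rewrite Cmod_R. Qed.

Lemma in_disk_conj (z : C) : in_disk z -> in_disk (Cconj z).
Proof. unfold in_disk. now rewrite Cmod_conj. Qed.

(** On the real diameter the real and imaginary parts are real power series,
    whose coefficients are determined by the sum near the origin. *)
Lemma expansion_unique (f g : C -> C) (a b : nat -> C) :
  eq_disk f g -> expansion f a -> expansion g b -> forall n, a n = b n.
Proof.
  intros Hfg Ha Hb n.
  assert (Hpart : forall (c : nat -> C) (h : C -> C), expansion h c ->
     forall x : R, (Rabs x < 1)%R ->
       is_pseries (fun n => Re (c n)) x (Re (h x)) /\
       is_pseries (fun n => Im (c n)) x (Im (h x))).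
  { intros c h Hc x Hx.
    assert (H := expansion_series _ _ _ Hc (in_disk_RtoC x Hx)).
    apply is_Cseries_components in H as [H1 H2].
    split; apply is_pseries_R.
    - refine (is_series_ext _ _ _ _ H1). intros k.
      rewrite <- RtoC_pow. unfold Re, Im, Cmult, RtoC; simpl. ring.
    - refine (is_series_ext _ _ _ _ H2). intros k.
      rewrite <- RtoC_pow. unfold Re, Im, Cmult, RtoC; simpl. ring. }
  assert (Hrad : forall u : nat -> R,
     (forall x : R, (Rabs x < 1)%R -> ex_pseries u x) ->
     Rbar_lt 0 (CV_radius u)).
  { intros u Hu.
    apply Rbar_lt_le_trans with (Finite (1/2)); [simpl; lra|].
    apply Rbar_not_lt_le. intros Hlt.
    apply (CV_disk_outside u (1/2)).
    - now rewrite Rabs_pos_eq by lra.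
    - apply ex_series_lim_0.
      destruct (Hu (1/2)%R) as [l Hl]; [rewrite Rabs_pos_eq; lra|].
      exists l. now apply is_pseries_R. }
  assert (Hloc : forall u v : nat -> R,
     (forall x : R, (Rabs x < 1)%R ->
        exists l : R, is_pseries u x l /\ is_pseries v x l) -> u n = v n).
  { intros u v Huv. apply PSeries_ext_recip.
    - apply Hrad. intros x Hx. destruct (Huv x Hx) as [l [H _]]. now exists l.
    - apply Hrad. intros x Hx. destruct (Huv x Hx) as [l [_ H]]. now exists l.
    - exists (mkposreal 1 Rlt_0_1). intros x Hx.
      destruct (Huv x) as [l [H1 H2]].
      + change (Rabs (x + - 0) < 1)%R in Hx.
        now rewrite Ropp_0, Rplus_0_r in Hx.
      + now rewrite (is_pseries_unique _ _ _ H1), (is_pseries_unique _ _ _ H2). }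
  assert (Eab : forall x : R, (Rabs x < 1)%R -> f x = g x).
  { intros x Hx. apply Hfg. now apply in_disk_RtoC. }
  rewrite (surjective_pairing (a n)), (surjective_pairing (b n)). f_equal.
  - apply (Hloc (fun k => Re (a k)) (fun k => Re (b k))).
    intros x Hx. exists (Re (f x)). split; [now apply Hpart|].
    rewrite Eab by exact Hx. now apply Hpart.
  - apply (Hloc (fun k => Im (a k)) (fun k => Im (b k))).
    intros x Hx. exists (Im (f x)). split; [now apply Hpart|].
    rewrite Eab by exact Hx. now apply Hpart.
Qed.

Lemma expansion_ext (f g : C -> C) (a : nat -> C) :
  eq_disk f g -> expansion g a -> expansion f a.
Proof. intros Hfg Ha z Hz. rewrite (Hfg z Hz). now apply Ha. Qed.

Lemma coef_expansion (f : C -> C) (a : nat -> C) :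
  expansion f a -> expansion f (coef f).
Proof. intros Ha. unfold coef. apply epsilon_spec. now exists a. Qed.

Lemma coef_unique (f : C -> C) (a : nat -> C) :
  expansion f a -> forall n, coef f n = a n.
Proof.
  intros Ha. apply (expansion_unique f f); [now intros z _|..|exact Ha].
  now apply coef_expansion with a.
Qed.

Lemma hardy_coef (f : C -> C) :
  hardy f -> expansion f (coef f) /\ ex_series (fun n => Cmod (coef f n) ^ 2)%R.
Proof.
  intros [a [Ha Ha2]]. split; [now apply coef_expansion with a|].
  apply ex_series_ext with (2 := Ha2). intros n. now rewrite (coef_unique f a).
Qed.

Lemma coef_ext (f g : C -> C) :
  eq_disk f g -> hardy g -> forall n, coef f n = coef g n.
Proof.
  intros Hfg Hg. apply coef_unique. apply expansion_ext with g; [exact Hfg|].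
  now apply hardy_coef.
Qed.

(** * Square-summable sequences *)

(** A bound on all partial sums carries summability and the bound on the squared
    norm at once, and passes to the limit termwise. *)
Definition energy_le (a : nat -> C) (A : R) : Prop :=
  forall N, (sum_n (fun n => Cmod (a n) ^ 2) N <= A)%R.

Lemma sum_n_term_le (u : nat -> R) (n : nat) :
  (forall k, (0 <= u k)%R) -> (0 <= sum_n u n /\ u n <= sum_n u n)%R.
Proof.
  intros Hu. induction n as [|n [IH _]].
  - rewrite sum_O. split; [apply Hu|apply Rle_refl].
  - rewrite sum_Sn. unfold plus; simpl. generalize (Hu (S n)). lra.
Qed.

Lemma sum_n_le_mono (u : nat -> R) (n m : nat) :
  (forall k, (0 <= u k)%R) -> (n <= m)%nat -> (sum_n u n <= sum_n u m)%R.
Proof.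
  intros Hu Hnm. induction Hnm as [|m _ IH]; [apply Rle_refl|].
  rewrite sum_Sn. unfold plus; simpl. generalize (Hu (S m)). lra.
Qed.

Lemma series_bounded_partial_sums (u : nat -> R) (A : R) :
  (forall k, (0 <= u k)%R) -> (forall N, (sum_n u N <= A)%R) ->
  ex_series u /\ (Series u <= A)%R.
Proof.
  intros Hu HA.
  destruct (ex_finite_lim_seq_incr (sum_n u) A) as [l Hl]; [|exact HA|].
  - intros n. apply sum_n_le_mono; [exact Hu|lia].
  - assert (Hs : is_series u l) by exact Hl.
    split; [now exists l|]. rewrite (is_series_unique _ _ Hs).
    apply (is_lim_seq_le _ _ l A HA Hl (is_lim_seq_const A)).
Qed.

Lemma sum_n_le_Series (u : nat -> R) (N : nat) :
  (forall k, (0 <= u k)%R) -> ex_series u -> (sum_n u N <= Series u)%R.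
Proof.
  intros Hu Hex.
  apply (is_lim_seq_le_loc (fun _ => sum_n u N) (sum_n u) (sum_n u N) (Series u)).
  - exists N. intros n Hn. now apply sum_n_le_mono.
  - apply is_lim_seq_const.
  - exact (Series_correct _ Hex).
Qed.

Lemma Cmod_le_of_energy (a : nat -> C) (A : R) :
  energy_le a A -> forall n, (Cmod (a n) <= sqrt A)%R.
Proof.
  intros HA n. rewrite <- (sqrt_pow2 (Cmod (a n))) by apply Cmod_ge_0.
  apply sqrt_le_1_alt. apply Rle_trans with (2 := HA n).
  apply (sum_n_term_le (fun n => Cmod (a n) ^ 2)%R). intros k. apply pow2_ge_0.
Qed.

Lemma energy_le_summable (a : nat -> C) (A : R) :
  energy_le a A ->
  ex_series (fun n => Cmod (a n) ^ 2)%R /\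
  (Series (fun n => Cmod (a n) ^ 2) <= A)%R.
Proof.
  intros HA. apply series_bounded_partial_sums; [|exact HA].
  intros k. apply pow2_ge_0.
Qed.

Lemma summable_energy_le (a : nat -> C) :
  ex_series (fun n => Cmod (a n) ^ 2)%R ->
  energy_le a (Series (fun n => Cmod (a n) ^ 2)%R).
Proof.
  intros Ha N. apply sum_n_le_Series; [|exact Ha]. intros k. apply pow2_ge_0.
Qed.

Lemma energy_le_lim_0 (a : nat -> C) (A : R) :
  energy_le a A -> is_lim_seq (fun n => Cmod (a n)) 0.
Proof.
  intros HA. destruct (energy_le_summable a A HA) as [Hex _].
  apply ex_series_lim_0 in Hex.
  apply is_lim_seq_ext with (fun n => sqrt (Cmod (a n) ^ 2)).
  { intros n. apply sqrt_pow2, Cmod_ge_0. }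
  rewrite <- sqrt_0.
  apply (is_lim_seq_continuous sqrt (fun n => (Cmod (a n) ^ 2)%R) 0); [|exact Hex].
  apply continuity_pt_filterlim. apply continuous_sqrt.
Qed.

(** * The disk and its automorphisms *)

Lemma one_minus_neq_0 (z w : C) : in_disk z -> in_disk w -> 1 - z * w <> 0.
Proof.
  unfold in_disk. intros Hz Hw E.
  assert (E1 : z * w = 1) by (replace (z * w) with (1 - (1 - z * w)) by ring;
                              rewrite E; ring).
  apply (f_equal Cmod) in E1. rewrite Cmod_mult, Cmod_1 in E1.
  generalize (Cmod_ge_0 z) (Cmod_ge_0 w). nra.
Qed.

Lemma one_plus_mult_conj_neq_0 (p : C) : in_disk p -> 1 + p * Cconj p <> 0.
Proof.
  intros Hp. replace (1 + p * Cconj p) with (1 - (- p) * Cconj p) by ring.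
  apply one_minus_neq_0; [|now apply in_disk_conj].
  unfold in_disk. now rewrite Cmod_opp.
Qed.

Lemma in_disk_unimodular (lambda z : C) :
  Cmod lambda = 1%R -> in_disk z -> in_disk (lambda * z).
Proof. unfold in_disk. intros Hl Hz. rewrite Cmod_mult, Hl. lra. Qed.

(** [|1 - conj q z|^2 - |q - z|^2 = (1 - |q|^2) (1 - |z|^2)]. *)
Lemma in_disk_alpha (q z : C) : in_disk q -> in_disk z -> in_disk (alpha q z).
Proof.
  intros Hq Hz. assert (Hn := one_minus_neq_0 _ _ (in_disk_conj q Hq) Hz).
  unfold in_disk, alpha in *. rewrite Cmod_div by exact Hn.
  apply Cmod_gt_0 in Hn as Hp.
  apply (Rmult_lt_reg_r _ _ _ Hp). unfold Rdiv.
  rewrite Rmult_assoc, Rinv_l, Rmult_1_r, Rmult_1_l by lra.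
  apply Rsqr_incrst_0; [|apply Cmod_ge_0|apply Cmod_ge_0].
  rewrite !Rsqr_pow2.
  assert (E : (Cmod (1 - Cconj q * z) ^ 2 - Cmod (q - z) ^ 2
               = (1 - Cmod q ^ 2) * (1 - Cmod z ^ 2))%R).
  { rewrite !Cmod2_alt. unfold Re, Im, Cconj; simpl. ring. }
  assert (0 < (1 - Cmod q ^ 2) * (1 - Cmod z ^ 2))%R.
  { generalize (Cmod_ge_0 q) (Cmod_ge_0 z). intros. apply Rmult_lt_0_compat; nra. }
  lra.
Qed.

(** * Weighted composition with a disk automorphism is a contraction *)

Definition automorphism (lambda q z : C) : C := lambda * alpha q z.

Lemma in_disk_automorphism (lambda q z : C) :
  Cmod lambda = 1%R -> in_disk q -> in_disk z -> in_disk (automorphism lambda q z).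
Proof. intros. apply in_disk_unimodular; [|apply in_disk_alpha]; assumption. Qed.

(** The value at [c] of the [j]-th backward shift of the power series [a]. As a
    sequence in [j] it is the bounded solution [t] of [a j = t j - c * t (S j)]. *)
Definition shifted_sum (c : C) (a : nat -> C) (j : nat) : C :=
  psum (fun n => a (j + n)%nat) c.

(** With [sigma = automorphism lambda q] and [c = lambda * q = sigma 0], this is the
    backward shift on Taylor coefficients at 0, conjugated by
    [f |-> k_q * (f o sigma)]: if [f] has coefficients [a], the function with these
    coefficients is
    [lambda * ((1 - conj c u) f u - (1 - |c|^2) f c) / (c - u)]. *)
Definition transported_shift (lambda q : C) (a : nat -> C) (j : nat) : C :=
  Cconj q * shifted_sum (lambda * q) a j
  - lambda * shifted_sum (lambda * q) a (S j).

Lemma psum_ext (a b : nat -> C) (z : C) :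
  (forall n, a n = b n) -> psum a z = psum b z.
Proof.
  intros H. unfold psum, CSeries. f_equal; apply Series_ext; intros n; now rewrite H.
Qed.

Lemma shifted_sum_rec (c : C) (a : nat -> C) (M : R) (j : nat) :
  (forall n, (Cmod (a n) <= M)%R) -> in_disk c ->
  shifted_sum c a j = a j + c * shifted_sum c a (S j).
Proof.
  intros HM Hc. unfold shifted_sum.
  rewrite (psum_decr _ M) by auto. rewrite Nat.add_0_r. f_equal. f_equal.
  apply psum_ext. intros n. f_equal. lia.
Qed.

Lemma Cmod_shifted_sum_le (c : C) (a : nat -> C) (M : R) (j : nat) :
  (forall n, (j <= n)%nat -> (Cmod (a n) <= M)%R) -> in_disk c ->
  (Cmod (shifted_sum c a j) <= M / (1 - Cmod c))%R.
Proof.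
  intros HM Hc. apply Cmod_psum_le; [|exact Hc]. intros n. apply HM. lia.
Qed.

Lemma shifted_sum_lim_0 (c : C) (a : nat -> C) :
  is_lim_seq (fun n => Cmod (a n)) 0 -> in_disk c ->
  is_lim_seq (fun j => Cmod (shifted_sum c a j)) 0.
Proof.
  intros Ha Hc. apply is_lim_seq_spec. intros eps.
  assert (Hpos : (0 < 1 - Cmod c)%R) by (unfold in_disk in Hc; lra).
  assert (He : (0 < eps * (1 - Cmod c) / 2)%R).
  { generalize (cond_pos eps). intros. apply Rdiv_lt_0_compat; [|lra].
    now apply Rmult_lt_0_compat. }
  apply is_lim_seq_spec in Ha. destruct (Ha (mkposreal _ He)) as [N HN].
  exists N. intros j Hj. simpl in HN.
  rewrite Rminus_0_r, Rabs_pos_eq by apply Cmod_ge_0.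
  apply Rle_lt_trans with (eps * (1 - Cmod c) / 2 / (1 - Cmod c))%R.
  - apply Cmod_shifted_sum_le; [|exact Hc]. intros n Hn.
    specialize (HN n ltac:(lia)).
    rewrite Rminus_0_r, Rabs_pos_eq in HN by apply Cmod_ge_0. lra.
  - generalize (cond_pos eps). intros.
    replace (eps * (1 - Cmod c) / 2 / (1 - Cmod c))%R with (eps / 2)%R by (field; lra).
    lra.
Qed.

(** With [t] the shifted sums and [v = lambda * t (S j)], the two sequences have
    entries [t j - q v] and [conj q * t j - v], and
    [|t j - q v|^2 - |conj q * t j - v|^2 = (1 - |q|^2) (|t j|^2 - |v|^2)]
    telescopes because [|v| = |t (S j)|]. *)
Lemma transported_shift_energy (lambda q : C) (a : nat -> C) (M : R) (N : nat) :
  Cmod lambda = 1%R -> in_disk q -> (forall n, (Cmod (a n) <= M)%R) ->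
  (sum_n (fun n => Cmod (transported_shift lambda q a n) ^ 2) N
   = sum_n (fun n => Cmod (a n) ^ 2) N
     - (1 - Cmod q ^ 2) * (Cmod (shifted_sum (lambda * q) a 0) ^ 2
                           - Cmod (shifted_sum (lambda * q) a (S N)) ^ 2))%R.
Proof.
  intros Hl Hq HM. assert (Hc := in_disk_unimodular _ _ Hl Hq).
  assert (Hloc : forall j,
    (Cmod (transported_shift lambda q a j) ^ 2
     = Cmod (a j) ^ 2
       - (1 - Cmod q ^ 2) * (Cmod (shifted_sum (lambda * q) a j) ^ 2
                             - Cmod (shifted_sum (lambda * q) a (S j)) ^ 2))%R).
  { intros j. assert (E := shifted_sum_rec _ a M j HM Hc).
    unfold transported_shift.
    set (t := shifted_sum (lambda * q) a j) in *.
    set (t' := shifted_sum (lambda * q) a (S j)) in *.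
    replace (a j) with (t - q * (lambda * t')) by (rewrite E; ring).
    replace (Cmod t')%R with (Cmod (lambda * t')) by (rewrite Cmod_mult, Hl; ring).
    generalize (lambda * t'). intros v.
    rewrite !Cmod2_alt. unfold Re, Im, Cconj; simpl. ring. }
  induction N as [|N IH].
  - rewrite !sum_O. apply Hloc.
  - rewrite !sum_Sn, IH, Hloc. unfold plus; simpl. ring.
Qed.

(** The boundary term of the telescoping identity tends to 0. Summing up to a large
    [m] and letting [m] go to infinity keeps the whole amount
    [(1 - |q|^2) |t 0|^2] available for the extracted coefficient. *)
Lemma transported_shift_energy_le (lambda q : C) (a : nat -> C) (A : R) :
  Cmod lambda = 1%R -> in_disk q -> energy_le a A ->
  energy_le (transported_shift lambda q a)
    (A - (1 - Cmod q ^ 2) * Cmod (shifted_sum (lambda * q) a 0) ^ 2)%R.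
Proof.
  intros Hl Hq HA N. assert (Hc := in_disk_unimodular _ _ Hl Hq).
  set (D := (1 - Cmod q ^ 2)%R).
  set (t := fun j => Cmod (shifted_sum (lambda * q) a j)).
  assert (Ht : is_lim_seq t 0)
    by (apply shifted_sum_lim_0; [now apply energy_le_lim_0 with A|exact Hc]).
  set (s := sum_n (fun n => Cmod (transported_shift lambda q a n) ^ 2)%R N).
  apply (is_lim_seq_le_loc (fun _ => s)
    (fun m => A - D * t O ^ 2 + D * (t (S m) * t (S m)))%R
    s (A - D * t O ^ 2)%R).
  - exists N. intros m Hm.
    apply Rle_trans with
      (sum_n (fun n => Cmod (transported_shift lambda q a n) ^ 2)%R m).
    + apply sum_n_le_mono; [|exact Hm]. intros k. apply pow2_ge_0.
    + rewrite (transported_shift_energy _ _ _ (sqrt A))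
        by (try assumption; now apply Cmod_le_of_energy).
      generalize (HA m). unfold D, t. lra.
  - apply is_lim_seq_const.
  - replace (Finite (A - D * t O ^ 2)) with (Finite (A - D * t O ^ 2 + D * (0 * 0)))
      by (f_equal; ring).
    apply is_lim_seq_plus'; [apply is_lim_seq_const|].
    apply is_lim_seq_mult'; [apply is_lim_seq_const|].
    apply is_lim_seq_mult'; now apply (is_lim_seq_incr_1 t 0).
Qed.

(** With [t] the shifted sums, [u = sigma z] and [T] the series with coefficients
    [t (S j)], the recurrence for [t] gives
    [f u = t 0 + (u - lambda q) T] and [f' u = conj q (t 0 + u T) - lambda T]; the
    claim is then a rational identity in [z], with [T] and [t 0] free. *)
Lemma transported_shift_spec (lambda q z : C) (a : nat -> C) (M : R) :
  Cmod lambda = 1%R -> in_disk q -> in_disk z ->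
  (forall n, (Cmod (a n) <= M)%R) ->
  normalized_kernel q z * psum a (automorphism lambda q z)
  = RtoC (sqrt (1 - Cmod q ^ 2)) * shifted_sum (lambda * q) a 0
    + z * (normalized_kernel q z
           * psum (transported_shift lambda q a) (automorphism lambda q z)).
Proof.
  intros Hl Hq Hz HM. assert (Hc := in_disk_unimodular _ _ Hl Hq).
  assert (Hu := in_disk_automorphism _ _ _ Hl Hq Hz).
  assert (Hn := one_minus_neq_0 _ _ (in_disk_conj q Hq) Hz).
  set (u := automorphism lambda q z) in *.
  set (t := shifted_sum (lambda * q) a).
  set (T := psum (fun j => t (S j)) u).
  assert (Ht : forall n, (Cmod (t n) <= M / (1 - Cmod (lambda * q)))%R).
  { intros n. apply Cmod_shifted_sum_le; [auto|exact Hc]. }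
  assert (E0 : psum t u = t O + u * T) by (apply psum_decr with (1 := Ht); exact Hu).
  assert (Ea : psum a u = t O + (u - lambda * q) * T).
  { rewrite (psum_ext a (fun j => 1 * t j + (- (lambda * q)) * t (S j))).
    - rewrite (psum_lin _ _ _ _ (M / (1 - Cmod (lambda * q)))) by auto.
      fold T. rewrite E0. ring.
    - intros j. unfold t at 1. rewrite (shifted_sum_rec _ a M j HM Hc).
      fold t. ring. }
  assert (Es : psum (transported_shift lambda q a) u
               = Cconj q * (t O + u * T) - lambda * T).
  { rewrite (psum_ext _ (fun j => Cconj q * t j + (- lambda) * t (S j))).
    - rewrite (psum_lin _ _ _ _ (M / (1 - Cmod (lambda * q)))) by auto.
      fold T. rewrite E0. ring.
    - intros j. unfold transported_shift. fold t. ring. }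
  rewrite Ea, Es. unfold u, automorphism, alpha, normalized_kernel.
  field. exact Hn.
Qed.

(** Iterating the transported shift [it] extracts the coefficients [b m] of the
    weighted composition one by one; see the introduction. *)
Lemma weighted_automorphism_expansion (lambda q : C) (a : nat -> C) (A : R) :
  Cmod lambda = 1%R -> in_disk q -> energy_le a A ->
  exists b : nat -> C,
    energy_le b A /\
    forall z, in_disk z ->
      is_Cseries (fun n => b n * z ^ n)
        (normalized_kernel q z * psum a (automorphism lambda q z)).
Proof.
  intros Hl Hq HA.
  set (d := sqrt (1 - Cmod q ^ 2)).
  assert (Hd : (0 <= 1 - Cmod q ^ 2)%R)
    by (unfold in_disk in Hq; generalize (Cmod_ge_0 q); nra).
  set (it := fun m => Nat.iter m (transported_shift lambda q) a).
  set (b := fun m => RtoC d * shifted_sum (lambda * q) (it m) 0).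
  assert (Hb : forall m, (Cmod (b m) ^ 2
     = (1 - Cmod q ^ 2) * Cmod (shifted_sum (lambda * q) (it m) 0) ^ 2)%R).
  { intros m. unfold b. rewrite Cmod_mult, Cmod_R, Rpow_mult_distr, pow2_abs.
    unfold d. now rewrite pow2_sqrt. }
  assert (Hen : forall m,
     energy_le (it (S m)) (A - sum_n (fun n => Cmod (b n) ^ 2) m)%R).
  { induction m as [|m IH].
    - rewrite sum_O, Hb. now apply transported_shift_energy_le.
    - rewrite sum_Sn, Hb. unfold plus; simpl plus.
      replace (A - _)%R with
        (A - sum_n (fun n => Cmod (b n) ^ 2) m
         - (1 - Cmod q ^ 2) * Cmod (shifted_sum (lambda * q) (it (S m)) 0) ^ 2)%R
        by (simpl; ring).
      now apply transported_shift_energy_le. }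
  assert (Hpos : forall (c : nat -> C) B, energy_le c B -> (0 <= B)%R).
  { intros c B HB. apply Rle_trans with (2 := HB O). rewrite sum_O. apply pow2_ge_0. }
  assert (HbA : energy_le b A) by (intros m; generalize (Hpos _ _ (Hen m)); lra).
  exists b. split; [exact HbA|]. intros z Hz.
  set (u := automorphism lambda q z).
  assert (Hu : in_disk u) by now apply in_disk_automorphism.
  assert (HitA : forall m, energy_le (it m) A).
  { intros [|m] N; [apply HA|].
    apply Rle_trans with (1 := Hen m N).
    generalize (proj1 (sum_n_term_le (fun n => Cmod (b n) ^ 2)%R m
                  (fun k => pow2_ge_0 _))). lra. }
  assert (Hstep : forall m,
     normalized_kernel q z * psum (it m) u
     = b m + z * (normalized_kernel q z * psum (it (S m)) u)).
  { intros m. apply transported_shift_spec with (sqrt A); try assumption.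
    now apply Cmod_le_of_energy. }
  assert (Hrem : forall m,
     normalized_kernel q z * psum a u
     - @sum_n C_AbelianMonoid (fun n => b n * z ^ n) m
     = z ^ S m * (normalized_kernel q z * psum (it (S m)) u)).
  { induction m as [|m IH].
    - rewrite sum_O. change a with (it O). rewrite Hstep. simpl. ring.
    - rewrite sum_Sn.
      change (normalized_kernel q z * psum a u
              - (@sum_n C_AbelianMonoid (fun n => b n * z ^ n) m
                 + b (S m) * z ^ S m)
              = z ^ S (S m) * (normalized_kernel q z * psum (it (S (S m))) u)).
      
      match goal with |- ?F - (?s + ?t) = _ =>
        replace (F - (s + t)) with (F - s - t) by ring end.
      rewrite IH, Hstep. rewrite (Cpow_S z (S m)). ring. }
  set (K := (Cmod (normalized_kernel q z) * (sqrt A / (1 - Cmod u)))%R).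
  apply is_Cseries_of_remainder with (fun m => (Cmod z ^ S m * K)%R).
  - intros m. rewrite Hrem, !Cmod_mult, Cmod_pow.
    apply Rmult_le_compat_l; [apply pow_le, Cmod_ge_0|].
    apply Rmult_le_compat_l; [apply Cmod_ge_0|].
    apply Cmod_psum_le; [now apply Cmod_le_of_energy|exact Hu].
  - replace (Finite 0) with (Finite (0 * K)) by (f_equal; ring).
    apply is_lim_seq_mult'; [|apply is_lim_seq_const].
    apply (is_lim_seq_incr_1 (fun m => (Cmod z ^ m)%R) 0).
    apply is_lim_seq_geom. rewrite Rabs_pos_eq; [exact Hz|apply Cmod_ge_0].
Qed.

(** * The conjugation *)

Lemma hardy_of_expansion (f : C -> C) (a : nat -> C) (A : R) :
  expansion f a -> energy_le a A -> hardy f /\ (hnorm f <= sqrt A)%R.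
Proof.
  intros Ha HA. destruct (energy_le_summable a A HA) as [Hex Hle].
  split; [now exists a|]. apply sqrt_le_1_alt.
  rewrite (Series_ext _ (fun n => Cmod (a n) ^ 2)%R); [exact Hle|].
  intros n. now rewrite (coef_unique f a).
Qed.

Lemma hnorm_ext (f g : C -> C) : eq_disk f g -> hardy g -> hnorm f = hnorm g.
Proof.
  intros Hfg Hg. unfold hnorm. f_equal. apply Series_ext.
  intros n. now rewrite (coef_ext f g).
Qed.

Lemma hardy_energy (f : C -> C) :
  hardy f -> energy_le (coef f) (Series (fun n => Cmod (coef f n) ^ 2)%R).
Proof. intros Hf. now apply summable_energy_le, hardy_coef. Qed.

Lemma hardy_psum (f : C -> C) (z : C) :
  hardy f -> in_disk z -> psum (coef f) z = f z.
Proof.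
  intros Hf Hz. apply CSeries_unique, expansion_series; [|exact Hz].
  now apply hardy_coef.
Qed.

Lemma hardy_lin (a b : C) (f g : C -> C) :
  hardy f -> hardy g -> hardy (fun z => a * f z + b * g z).
Proof.
  intros Hf Hg. apply hardy_coef in Hf as [Ef Sf]. apply hardy_coef in Hg as [Eg Sg].
  exists (fun n => a * coef f n + b * coef g n). split.
  - intros z Hz. apply is_pseries_C.
    apply is_Cseries_ext with
      (fun n => a * (coef f n * z ^ n) + b * (coef g n * z ^ n)).
    { intros n. ring. }
    apply is_Cseries_plus; apply is_Cseries_scal; now apply expansion_series.
  - apply (@ex_series_le R_AbsRing R_CompleteNormedModule) with
      (fun n => (2 * Cmod a ^ 2) * (Cmod (coef f n) ^ 2)
                + (2 * Cmod b ^ 2) * (Cmod (coef g n) ^ 2))%R.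
    + intros n. change (norm ?x) with (Rabs x).
      rewrite Rabs_pos_eq by apply pow2_ge_0.
      assert (H := Cmod_triangle (a * coef f n) (b * coef g n)).
      rewrite !Cmod_mult in H.
      generalize (Cmod_ge_0 (a * coef f n + b * coef g n)).
      generalize (pow2_ge_0 (Cmod a * Cmod (coef f n) - Cmod b * Cmod (coef g n))).
      nra.
    + apply (@ex_series_plus R_AbsRing R_NormedModule);
        now apply (@ex_series_scal R_AbsRing R_NormedModule).
Qed.

Lemma wcomp_automorphism_contraction (lambda q : C) (f : C -> C) :
  Cmod lambda = 1%R -> in_disk q -> hardy f ->
  let g := wcomp (normalized_kernel q) (automorphism lambda q) f in
  hardy g /\ (hnorm g <= hnorm f)%R.
Proof.
  intros Hl Hq Hf g.
  destruct (weighted_automorphism_expansion lambda q _ _ Hl Hq (hardy_energy f Hf))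
    as [b [Hb Hg]].
  apply hardy_of_expansion with b; [|exact Hb].
  intros z Hz. apply is_pseries_C. unfold g, wcomp.
  rewrite <- (hardy_psum f) by (try apply in_disk_automorphism; assumption).
  now apply Hg.
Qed.

Lemma conjJ_eval (f : C -> C) (z : C) :
  hardy f -> in_disk z -> conjJ f z = Cconj (f (Cconj z)).
Proof.
  intros Hf Hz. apply CSeries_unique.
  apply is_Cseries_ext with (fun n => Cconj (coef f n * Cconj z ^ n)).
  { intros n. now rewrite Cmult_conj, Cpow_conj, Cconj_conj. }
  apply is_Cseries_conj, expansion_series; [now apply hardy_coef|].
  now apply in_disk_conj.
Qed.

Lemma conjJ_hardy (f : C -> C) :
  hardy f -> hardy (conjJ f) /\ (hnorm (conjJ f) <= hnorm f)%R.
Proof.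
  intros Hf. apply hardy_of_expansion with (fun n => Cconj (coef f n)).
  - intros z Hz. apply is_pseries_C. rewrite conjJ_eval by assumption.
    apply is_Cseries_ext with (fun n => Cconj (coef f n * Cconj z ^ n)).
    { intros n. now rewrite Cmult_conj, Cpow_conj, Cconj_conj. }
    apply is_Cseries_conj, expansion_series; [now apply hardy_coef|].
    now apply in_disk_conj.
  - intros N. rewrite (sum_n_ext _ (fun n => Cmod (coef f n) ^ 2)%R).
    + now apply hardy_energy.
    + intros n. now rewrite Cmod_conj.
Qed.

Definition automorphism_conjugation (lambda q : C) : operator :=
  fun f => conjJ (wcomp (normalized_kernel q) (automorphism lambda q) f).

Lemma automorphism_conjugation_eval (lambda q : C) (f : C -> C) (z : C) :
  Cmod lambda = 1%R -> in_disk q -> hardy f -> in_disk z ->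
  automorphism_conjugation lambda q f z
  = Cconj (normalized_kernel q (Cconj z) * f (automorphism lambda q (Cconj z))).
Proof.
  intros Hl Hq Hf Hz. unfold automorphism_conjugation.
  rewrite conjJ_eval; [reflexivity| |exact Hz].
  now apply wcomp_automorphism_contraction.
Qed.

Lemma automorphism_conjugation_contraction (lambda q : C) (f : C -> C) :
  Cmod lambda = 1%R -> in_disk q -> hardy f ->
  hardy (automorphism_conjugation lambda q f) /\
  (hnorm (automorphism_conjugation lambda q f) <= hnorm f)%R.
Proof.
  intros Hl Hq Hf.
  destruct (wcomp_automorphism_contraction lambda q f Hl Hq Hf) as [Hg Hgf].
  destruct (conjJ_hardy _ Hg) as [Hh Hhg].
  split; [exact Hh|]. now apply Rle_trans with (2 := Hgf).
Qed.

Lemma normalized_kernel_sqrt_neq_0 (q : C) :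
  in_disk q -> RtoC (sqrt (1 - Cmod q ^ 2)) <> 0.
Proof.
  unfold in_disk. intros Hq E. apply RtoC_inj in E.
  apply sqrt_eq_0 in E; generalize (Cmod_ge_0 q); nra.
Qed.

Lemma normalized_kernel_sqrt_sqr (q : C) :
  in_disk q ->
  RtoC (sqrt (1 - Cmod q ^ 2)) * RtoC (sqrt (1 - Cmod q ^ 2)) = 1 - q * Cconj q.
Proof.
  unfold in_disk. intros Hq. rewrite <- RtoC_mult, sqrt_sqrt.
  - now rewrite RtoC_minus, <- Cmod2_conj.
  - generalize (Cmod_ge_0 q). nra.
Qed.

Lemma Cmod_1_mult_conj (lambda : C) : Cmod lambda = 1%R -> lambda * Cconj lambda = 1.
Proof. intros Hl. rewrite <- Cmod2_conj, Hl. now rewrite pow1. Qed.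

Lemma Cconj_RtoC (x : R) : Cconj (RtoC x) = RtoC x.
Proof. unfold Cconj, RtoC; simpl. now rewrite Ropp_0. Qed.

Lemma Cconj_0 : Cconj 0 = 0.
Proof. apply Cconj_RtoC. Qed.

Lemma Cconj_1 : Cconj 1 = 1.
Proof. apply Cconj_RtoC. Qed.

Lemma Cconj_automorphism (lambda q z : C) :
  in_disk q -> in_disk z ->
  Cconj (automorphism lambda q z)
  = automorphism (Cconj lambda) (Cconj q) (Cconj z).
Proof.
  intros Hq Hz. unfold automorphism, alpha.
  rewrite Cmult_conj, Cdiv_conj by now apply one_minus_neq_0; [apply in_disk_conj|].
  now rewrite !Cminus_conj, Cmult_conj, Cconj_1.
Qed.

(** Conjugation turns [sigma] into [conj lambda * alpha (conj q)], which is the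
    inverse of [sigma] when [lambda * q = conj q]; this is where the value of
    [lambda] matters. *)
Lemma automorphism_conj_involutive (lambda q z : C) :
  Cmod lambda = 1%R -> in_disk q -> in_disk z -> lambda * q = Cconj q ->
  automorphism lambda q (Cconj (automorphism lambda q (Cconj z))) = z /\
  Cconj (normalized_kernel q (Cconj z))
  * normalized_kernel q (Cconj (automorphism lambda q (Cconj z))) = 1.
Proof.
  intros Hl Hq Hz Hlq. assert (Hl1 := Cmod_1_mult_conj _ Hl).
  assert (Hz' := in_disk_conj _ Hz). assert (Hq' := in_disk_conj _ Hq).
  assert (Hd := normalized_kernel_sqrt_neq_0 q Hq).
  assert (Hd2 := normalized_kernel_sqrt_sqr q Hq).
  rewrite Cconj_automorphism, Cconj_conj by assumption.
  (* Write everything in terms of [q], [lambda] and [mu = 1 / lambda]. *)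
  unfold automorphism, alpha, normalized_kernel.
  set (d := RtoC (sqrt (1 - Cmod q ^ 2))) in *.
  assert (N1 : 1 - q * z <> 0) by now apply one_minus_neq_0.
  assert (N2 : 1 - q * Cconj q <> 0) by now apply one_minus_neq_0.
  rewrite Cdiv_conj, Cminus_conj, Cmult_conj, !Cconj_conj, Cconj_1
    by now apply one_minus_neq_0.
  replace (Cconj d) with d by (symmetry; apply Cconj_RtoC).
  set (mu := Cconj lambda) in *.
  assert (Hq1 : Cconj q * mu = q)
    by (rewrite <- Hlq; replace (lambda * q * mu) with (lambda * mu * q) by ring;
        rewrite Hl1; ring).
  assert (E : 1 - Cconj q * (mu * ((Cconj q - z) / (1 - q * z)))
              = (1 - q * Cconj q) / (1 - q * z)).
  { replace (Cconj q * (mu * ((Cconj q - z) / (1 - q * z))))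
      with ((Cconj q * mu) * ((Cconj q - z) / (1 - q * z))) by ring.
    rewrite Hq1. field. exact N1. }
  rewrite E. split.
  - assert (E2 : lambda * ((q - mu * ((Cconj q - z) / (1 - q * z)))
                 / ((1 - q * Cconj q) / (1 - q * z)))
             = (lambda * q * (1 - q * z) - lambda * mu * (Cconj q - z))
               / (1 - q * Cconj q)).
    { field. now split. }
    rewrite E2, Hl1, Hlq. field. exact N2.
  - replace (d / (1 - q * z) * (d / ((1 - q * Cconj q) / (1 - q * z))))
      with (d * d / (1 - q * Cconj q)) by (field; now split).
    rewrite Hd2. field. exact N2.
Qed.

Lemma automorphism_conjugation_involutive (lambda q : C) (f : C -> C) :
  Cmod lambda = 1%R -> in_disk q -> lambda * q = Cconj q -> hardy f ->
  eq_disk (automorphism_conjugation lambda q (automorphism_conjugation lambda q f)) f.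
Proof.
  intros Hl Hq Hlq Hf z Hz.
  assert (Hw : in_disk (automorphism lambda q (Cconj z)))
    by now apply in_disk_automorphism, in_disk_conj.
  rewrite automorphism_conjugation_eval by
    (try assumption; now apply automorphism_conjugation_contraction).
  rewrite automorphism_conjugation_eval by assumption.
  destruct (automorphism_conj_involutive lambda q z Hl Hq Hz Hlq) as [E1 E2].
  rewrite E1, Cmult_conj, Cconj_conj.
  transitivity (Cconj (normalized_kernel q (Cconj z))
    * normalized_kernel q (Cconj (automorphism lambda q (Cconj z))) * f z); [ring|].
  rewrite E2. ring.
Qed.

(** Isometry follows from contraction and involution: [|f| = |J J f| <= |J f|]. *)
Lemma automorphism_conjugation_is_conjugation (lambda q : C) :
  Cmod lambda = 1%R -> in_disk q -> lambda * q = Cconj q ->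
  is_conjugation (automorphism_conjugation lambda q).
Proof.
  intros Hl Hq Hlq.
  assert (Hc := fun f => automorphism_conjugation_contraction lambda q f Hl Hq).
  split; [|split; [|split]].
  - intros f Hf. now apply Hc.
  - intros a b f g Hf Hg z Hz.
    rewrite !automorphism_conjugation_eval by (try assumption; now apply hardy_lin).
    rewrite <- !Cmult_conj, <- Cplus_conj. f_equal. ring.
  - intros f Hf. destruct (Hc f Hf) as [HJ Hle].
    apply Rle_antisym; [exact Hle|].
    rewrite <- (hnorm_ext _ _
      (automorphism_conjugation_involutive lambda q f Hl Hq Hlq Hf) Hf).
    now apply Hc.
  - intros f Hf. now apply automorphism_conjugation_involutive.
Qed.

(** * The adjoint, through reproducing kernels *)

Lemma kernel_expansion (w : C) :
  in_disk w -> expansion (kernel w) (fun n => Cconj w ^ n).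
Proof.
  intros Hw z Hz. apply is_pseries_C.
  assert (H1 : forall n : nat, (Cmod 1 <= 1)%R) by (intros _; rewrite Cmod_1; lra).
  assert (Hwz : in_disk (Cconj w * z)).
  { unfold in_disk in *. rewrite Cmod_mult, Cmod_conj.
    generalize (Cmod_ge_0 w) (Cmod_ge_0 z). nra. }
  assert (N := one_minus_neq_0 _ _ (in_disk_conj w Hw) Hz).
  assert (E : psum (fun _ => 1) (Cconj w * z) = kernel w z).
  { assert (E := psum_decr (fun _ => 1) 1 (Cconj w * z) H1 Hwz).
    unfold kernel.
    set (s := psum (fun _ => 1) (Cconj w * z)) in *.
    replace s with (s * (1 - Cconj w * z) / (1 - Cconj w * z)) by (field; exact N).
    replace (s * (1 - Cconj w * z)) with (s - Cconj w * z * s) by ring.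
    rewrite E at 1. field. exact N. }
  rewrite <- E.
  apply is_Cseries_ext with (2 := is_Cseries_psum _ 1 _ H1 Hwz).
  intros n. rewrite Cpow_mult_l. ring.
Qed.

Lemma kernel_hardy (w : C) : in_disk w -> hardy (kernel w).
Proof.
  intros Hw. exists (fun n => Cconj w ^ n). split; [now apply kernel_expansion|].
  apply ex_series_ext with (fun n => ((Cmod w ^ 2) ^ n)%R).
  { intros n. now rewrite Cmod_pow, Cmod_conj, <- !pow_mult, Nat.mul_comm. }
  apply ex_series_geom. unfold in_disk in Hw.
  rewrite Rabs_pos_eq by apply pow2_ge_0. generalize (Cmod_ge_0 w). nra.
Qed.

(** The reproducing property, for a multiple of a kernel in the first slot. *)
Lemma hinner_kernel (h g : C -> C) (kappa v : C) :
  in_disk v -> eq_disk h (fun x => kappa * kernel v x) -> hardy g ->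
  hinner h g = kappa * Cconj (g v).
Proof.
  intros Hv Hh Hg.
  assert (Eh : expansion h (fun n => kappa * Cconj v ^ n)).
  { apply expansion_ext with (1 := Hh). intros z Hz. apply is_pseries_C.
    apply is_Cseries_ext with (fun n => kappa * (Cconj v ^ n * z ^ n)).
    { intros n. ring. }
    apply is_Cseries_scal, expansion_series; [now apply kernel_expansion|exact Hz]. }
  apply CSeries_unique.
  apply is_Cseries_ext with (fun n => kappa * Cconj (coef g n * v ^ n)).
  { intros n. rewrite (coef_unique h _ Eh), Cmult_conj, Cpow_conj. ring. }
  apply is_Cseries_scal, is_Cseries_conj, expansion_series; [|exact Hv].
  now apply hardy_coef.
Qed.

(** Testing the adjoint relation against kernels determines every adjoint
    pointwise as soon as [T] maps kernels to multiples of kernels. *)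
Lemma adjoint_eval (T S : operator) (g : C -> C) (z v kappa : C) :
  is_adjoint T S -> hardy g -> in_disk z -> in_disk v ->
  eq_disk (T (kernel z)) (fun x => kappa * kernel v x) ->
  S g z = Cconj kappa * g v.
Proof.
  intros [[HS _] Hadj] Hg Hz Hv HT.
  assert (E := Hadj (kernel z) g (kernel_hardy z Hz) Hg).
  rewrite (hinner_kernel _ _ kappa v Hv HT Hg) in E.
  rewrite (hinner_kernel (kernel z) (S g) 1 z Hz) in E; [| |now apply HS].
  - apply (f_equal Cconj) in E. rewrite !Cmult_conj, !Cconj_conj, Cconj_1 in E.
    rewrite E. ring.
  - intros x _. ring.
Qed.

(** * Elliptic self-maps and the intertwining automorphism *)

Lemma alpha_involutive (p z : C) :
  in_disk p -> in_disk z -> alpha p (alpha p z) = z.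
Proof.
  intros Hp Hz. assert (Hp' := in_disk_conj _ Hp).
  assert (N1 := one_minus_neq_0 _ _ Hp' Hz).
  assert (N2 := one_minus_neq_0 _ _ Hp' (in_disk_alpha _ _ Hp Hz)).
  assert (N3 := one_minus_neq_0 _ _ Hp Hp').
  assert (E : 1 - Cconj p * alpha p z = (1 - p * Cconj p) / (1 - Cconj p * z)).
  { unfold alpha. field. exact N1. }
  unfold alpha at 1. rewrite E. unfold alpha. field. now split.
Qed.

Definition elliptic (p delta z : C) : C := alpha p (delta * alpha p z).

Lemma in_disk_contract (delta z : C) :
  (Cmod delta <= 1)%R -> in_disk z -> in_disk (delta * z).
Proof.
  unfold in_disk. intros Hd Hz. rewrite Cmod_mult.
  generalize (Cmod_ge_0 delta) (Cmod_ge_0 z). nra.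
Qed.

Lemma in_disk_elliptic (p delta z : C) :
  in_disk p -> (Cmod delta <= 1)%R -> in_disk z -> in_disk (elliptic p delta z).
Proof.
  intros Hp Hd Hz.
  now apply in_disk_alpha, in_disk_contract, in_disk_alpha.
Qed.

Lemma Cconj_alpha (p z : C) :
  in_disk p -> in_disk z -> Cconj (alpha p z) = alpha (Cconj p) (Cconj z).
Proof.
  intros Hp Hz. unfold alpha.
  rewrite Cdiv_conj by now apply one_minus_neq_0; [apply in_disk_conj|].
  now rewrite !Cminus_conj, Cmult_conj, Cconj_1.
Qed.

Lemma Cconj_elliptic (p delta z : C) :
  in_disk p -> (Cmod delta <= 1)%R -> in_disk z ->
  Cconj (elliptic p (Cconj delta) z) = elliptic (Cconj p) delta (Cconj z).
Proof.
  intros Hp Hd Hz. unfold elliptic.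
  rewrite Cconj_alpha, Cmult_conj, Cconj_alpha, Cconj_conj; auto.
  apply in_disk_contract; [now rewrite Cmod_conj|]. now apply in_disk_alpha.
Qed.

(** In the coordinates [s = alpha p x] and [t = alpha (conj p) w] both sides become
    [(1 - p' s) (1 - p t) / ((1 - |p|^2) (1 - delta s t))] with [p' = conj p], which
    treats the two variables alike. *)
Lemma elliptic_kernel_exchange (p delta x w : C) :
  in_disk p -> (Cmod delta <= 1)%R -> in_disk x -> in_disk w ->
  let X := elliptic p delta x in
  let Y := elliptic (Cconj p) delta w in
  (1 - Cconj p * X) / (1 - Cconj p * x) / (1 - w * X)
  = (1 - p * Y) / (1 - p * w) / (1 - Y * x).
Proof.
  intros Hp Hd Hx Hw X Y. assert (Hp' := in_disk_conj _ Hp).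
  assert (Hs := in_disk_alpha _ _ Hp Hx). assert (Ht := in_disk_alpha _ _ Hp' Hw).
  unfold X, Y, elliptic.
  rewrite <- (alpha_involutive p x Hp Hx) at 2 4.
  rewrite <- (alpha_involutive (Cconj p) w Hp' Hw) at 1 3.
  set (s := alpha p x) in *. set (t := alpha (Cconj p) w) in *.
  assert (Hds := in_disk_contract _ _ Hd Hs). assert (Hdt := in_disk_contract _ _ Hd Ht).
  assert (N1 := one_minus_neq_0 _ _ Hp' Hs). assert (N2 := one_minus_neq_0 _ _ Hp Ht).
  assert (N3 := one_minus_neq_0 _ _ Hp' Hds). assert (N4 := one_minus_neq_0 _ _ Hp Hdt).
  assert (N5 := one_minus_neq_0 _ _ Hp Hp'). assert (N6 := one_minus_neq_0 _ _ Hds Ht).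
  assert (A1 : forall u, 1 - Cconj p * u <> 0 ->
    1 - Cconj p * alpha p u = (1 - p * Cconj p) / (1 - Cconj p * u)).
  { intros u Hu. unfold alpha. field. exact Hu. }
  assert (A2 : forall u, 1 - p * u <> 0 ->
    1 - p * alpha (Cconj p) u = (1 - p * Cconj p) / (1 - p * u)).
  { intros u Hu. unfold alpha. rewrite Cconj_conj. field. exact Hu. }
  assert (A3 : forall u v, 1 - p * u <> 0 -> 1 - Cconj p * v <> 0 ->
    1 - alpha (Cconj p) u * alpha p v
    = (1 - p * Cconj p) * (1 - u * v) / ((1 - p * u) * (1 - Cconj p * v))).
  { intros u v Hu Hv. unfold alpha. rewrite Cconj_conj. field. now split. }
  rewrite !A1, !A2, !A3 by assumption.
  field. repeat split; try assumption.
  all: intros E; apply N6; rewrite <- E; ring.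
Qed.

Lemma elliptic_wcomp_kernel (psi phi : C -> C) (p gamma delta z : C) :
  in_disk p -> (Cmod delta <= 1)%R -> in_disk z ->
  (forall x, in_disk x -> psi x = gamma * (kernel p x / kernel p (phi x))) ->
  (forall x, in_disk x -> phi x = elliptic p delta x) ->
  let v := elliptic p (Cconj delta) z in
  eq_disk (wcomp psi phi (kernel z))
    (fun x => gamma * ((1 - p * Cconj v) / (1 - p * Cconj z)) * kernel v x).
Proof.
  intros Hp Hd Hz Hpsi Hphi v x Hx. unfold wcomp.
  assert (HX := in_disk_elliptic _ _ _ Hp Hd Hx).
  assert (Hv : in_disk v)
    by (apply in_disk_elliptic; try assumption; now rewrite Cmod_conj).
  assert (Hp' := in_disk_conj _ Hp). assert (Hz' := in_disk_conj _ Hz).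
  assert (Hv' := in_disk_conj _ Hv).
  assert (E := elliptic_kernel_exchange p delta x (Cconj z) Hp Hd Hx Hz').
  simpl in E. rewrite <- Cconj_elliptic in E by assumption. fold v in E.
  rewrite Hpsi, Hphi by assumption. unfold kernel.
  transitivity (gamma * ((1 - Cconj p * elliptic p delta x) / (1 - Cconj p * x)
                         / (1 - Cconj z * elliptic p delta x))).
  - field. repeat split; now apply one_minus_neq_0.
  - rewrite E. field. repeat split; now apply one_minus_neq_0.
Qed.

(** The equation says that [sigma] maps [conj p] to [p], solved for [conj q] with
    [lambda * q = conj q]. Both the value of [lambda] for [q <> 0] and the
    restriction [lambda = -1] for [q = 0] and [p <> 0] come from it. *)
Lemma intertwining_pole (p lambda q : C) :
  in_disk p -> q = (p - Cconj p) / (Cpow p 2 - 1) ->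
  (q <> 0 -> lambda = Cconj q / q) ->
  (q = 0 -> p <> 0 -> lambda = -1) ->
  Cconj q = (p + lambda * Cconj p) / (1 + p * Cconj p).
Proof.
  intros Hp Hq Hl1 Hl0. assert (Hp' := in_disk_conj _ Hp).
  assert (N1 : p * p - 1 <> 0).
  { intros E. apply (one_minus_neq_0 p p Hp Hp).
    replace (1 - p * p) with (- (p * p - 1)) by ring. rewrite E. ring. }
  assert (N2 : Cconj p * Cconj p - 1 <> 0).
  { intros E. apply (one_minus_neq_0 _ _ Hp' Hp').
    replace (1 - Cconj p * Cconj p) with (- (Cconj p * Cconj p - 1)) by ring.
    rewrite E. ring. }
  assert (N3 := one_plus_mult_conj_neq_0 p Hp).
  replace (Cpow p 2) with (p * p) in Hq by (simpl; ring).
  assert (Hq' : Cconj q = (Cconj p - p) / (Cconj p * Cconj p - 1)).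
  { rewrite Hq, Cdiv_conj by exact N1.
    now rewrite !Cminus_conj, Cmult_conj, Cconj_conj, Cconj_1. }
  destruct (Ceq_dec q 0) as [E0|E0].
  - assert (Ep : Cconj p = p).
    { rewrite E0 in Hq.
      assert (E : p - Cconj p = 0 * (p * p - 1)) by (rewrite Hq; field; exact N1).
      replace p with (p - Cconj p + Cconj p) at 2 by ring. rewrite E. ring. }
    rewrite E0, Cconj_0.
    destruct (Ceq_dec p 0) as [Ep0|Ep0].
    + rewrite Ep, Ep0. field.
    + rewrite (Hl0 E0 Ep0). rewrite Ep in *. field. exact N3.
  - rewrite (Hl1 E0), Hq', Hq. field. repeat split; try assumption.
    intros E. apply E0. rewrite Hq, E. unfold Cdiv. ring.
Qed.

(** [alpha p o sigma o alpha (conj p)] is an automorphism of the disk that fixes 0,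
    hence a rotation. The second identity, for the denominators, is what compares
    the kernels [K_p o sigma] and [K_(conj p)]. *)
Lemma alpha_automorphism (p lambda q w : C) :
  in_disk p -> Cmod lambda = 1%R -> in_disk q -> in_disk w ->
  lambda * q = Cconj q ->
  Cconj q = (p + lambda * Cconj p) / (1 + p * Cconj p) ->
  alpha p (automorphism lambda q w)
  = (p * p - lambda) / (1 - lambda * Cconj p * Cconj p) * alpha (Cconj p) w /\
  1 - Cconj p * automorphism lambda q w
  = (1 - lambda * Cconj p * Cconj p) * (1 - p * w)
    / ((1 + p * Cconj p) * (1 - Cconj q * w)).
Proof.
  intros Hp Hl Hq Hw Hlq Hq'. assert (Hp' := in_disk_conj _ Hp).
  assert (N1 := one_minus_neq_0 _ _ Hp Hw).
  assert (N2 := one_minus_neq_0 _ _ (in_disk_conj _ Hq) Hw).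
  assert (N3 := one_plus_mult_conj_neq_0 p Hp).
  assert (N4 : 1 - lambda * Cconj p * Cconj p <> 0).
  { apply one_minus_neq_0; [|exact Hp']. now apply in_disk_unimodular. }
  assert (Es : automorphism lambda q w = (Cconj q - lambda * w) / (1 - Cconj q * w)).
  { unfold automorphism, alpha. rewrite <- Hlq at 2. field. exact N2. }
  (* [D] clears the denominator of [Cconj q] from [1 - Cconj q * w]. *)
  set (D := 1 + p * Cconj p - (p + lambda * Cconj p) * w).
  assert (ED : 1 - Cconj q * w = D / (1 + p * Cconj p))
    by (rewrite Hq'; unfold D; field; exact N3).
  assert (ND : D <> 0).
  { intros E. apply N2. rewrite ED, E. unfold Cdiv. ring. }
  rewrite ED in Es. rewrite Hq' in Es.
  assert (E1 : 1 - Cconj p * automorphism lambda q w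
               = (1 - lambda * Cconj p * Cconj p) * (1 - p * w) / D).
  { rewrite Es. unfold D. field. now split. }
  split.
  - unfold alpha. rewrite E1, Es, Cconj_conj. unfold D. field. repeat split; assumption.
  - rewrite E1, ED. field. now split.
Qed.

(** [|p^2 - 1|^2 - |p - conj p|^2 = (1 - |p|^2)^2]. *)
Lemma pole_in_disk (p : C) :
  in_disk p -> in_disk ((p - Cconj p) / (Cpow p 2 - 1)).
Proof.
  intros Hp.
  assert (N : Cpow p 2 - 1 <> 0).
  { intros E. apply (one_minus_neq_0 p p Hp Hp).
    replace (1 - p * p) with (- (Cpow p 2 - 1)) by (simpl; ring). rewrite E. ring. }
  unfold in_disk in *. rewrite Cmod_div by exact N. apply Cmod_gt_0 in N.
  apply (Rmult_lt_reg_r _ _ _ N). unfold Rdiv.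
  rewrite Rmult_assoc, Rinv_l, Rmult_1_r, Rmult_1_l by lra.
  apply Rsqr_incrst_0; [|apply Cmod_ge_0|apply Cmod_ge_0].
  rewrite !Rsqr_pow2.
  assert (E : (Cmod (Cpow p 2 - 1) ^ 2 - Cmod (p - Cconj p) ^ 2
               = (1 - Cmod p ^ 2) ^ 2)%R).
  { rewrite !Cmod2_alt. unfold Re, Im, Cconj; simpl. ring. }
  assert (0 < (1 - Cmod p ^ 2) ^ 2)%R.
  { apply pow_lt. generalize (Cmod_ge_0 p). nra. }
  lra.
Qed.

Theorem theorem4 :
  forall (psi phi : C -> C) (p gamma delta : C),
    in_disk p ->
    (Cmod delta <= 1)%R ->
    holomorphic_disk psi ->
    holomorphic_disk phi ->
    self_map_disk phi ->
    phi p = p ->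
    (forall z, in_disk z -> psi z = gamma * (kernel p z / kernel p (phi z))) ->
    (forall z, in_disk z -> phi z = alpha p (delta * alpha p z)) ->
    normal_operator (wcomp psi phi) ->
    forall q lambda : C,
      q = (p - Cconj p) / (Cpow p 2 - 1) ->
      (q <> 0 -> lambda = Cconj q / q) ->
      (q = 0 -> Cmod lambda = 1%R) ->
      let sigma := fun z => lambda * ((q - z) / (1 - Cconj q * z)) in
      let J := fun f => conjJ (wcomp (normalized_kernel q) sigma f) in
      is_conjugation J /\
      (* For q = 0 (p real) and p <> 0 the intertwining relation fails for
         unimodular lambda <> -1. *)
      ((q = 0 -> p <> 0 -> lambda = -1) ->
       complex_symmetric_with (wcomp psi phi) J).
Proof.
  intros psi phi p gamma delta Hp Hd _ _ _ _ Hpsi Hphi [HT [S [HS _]]]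
    q lambda Hq Hl1 Hl0 sigma J.
  change J with (automorphism_conjugation lambda q). clear sigma J.
  assert (Hqd : in_disk q) by (rewrite Hq; now apply pole_in_disk).
  assert (Hl : Cmod lambda = 1%R).
  { destruct (Ceq_dec q 0) as [E|E]; [now apply Hl0|].
    rewrite (Hl1 E), Cmod_div, Cmod_conj by exact E.
    apply Rdiv_diag. apply Cmod_gt_0 in E. lra. }
  assert (Hlq : lambda * q = Cconj q).
  { destruct (Ceq_dec q 0) as [E|E].
    - rewrite E, Cconj_0. ring.
    - rewrite (Hl1 E). field. exact E. }
  assert (HJ := automorphism_conjugation_is_conjugation lambda q Hl Hqd Hlq).
  split; [exact HJ|]. intros Hl0'.
  assert (Hq' := intertwining_pole p lambda q Hp Hq Hl1 Hl0').
  split; [exact HT|]. split; [exact HJ|].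
  exists S. split; [exact HS|]. intros f Hf z Hz.
  assert (Hp' := in_disk_conj _ Hp). assert (Hq'd := in_disk_conj _ Hqd).
  set (v := elliptic p (Cconj delta) z).
  assert (Hv : in_disk v)
    by (apply in_disk_elliptic; try assumption; now rewrite Cmod_conj).
  rewrite automorphism_conjugation_eval by (try assumption; now apply HT).
  rewrite (adjoint_eval _ S _ z v _ HS (proj1 HJ f Hf) Hz Hv
    (elliptic_wcomp_kernel psi phi p gamma delta z Hp Hd Hz Hpsi Hphi)).
  rewrite automorphism_conjugation_eval by assumption.
  rewrite <- Cmult_conj. f_equal. fold v.
  assert (Ev : Cconj v = elliptic (Cconj p) delta (Cconj z))
    by now apply Cconj_elliptic.
  assert (Hw := in_disk_conj _ Hz). assert (Hy := in_disk_conj _ Hv).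
  set (w := Cconj z) in *. set (y := Cconj v) in *.
  destruct (alpha_automorphism p lambda q w Hp Hl Hqd Hw Hlq Hq') as [Aw Bw].
  destruct (alpha_automorphism p lambda q y Hp Hl Hqd Hy Hlq Hq') as [Ay By].
  assert (Hsw := in_disk_automorphism _ _ _ Hl Hqd Hw).
  assert (Hsy := in_disk_automorphism _ _ _ Hl Hqd Hy).
  (* Apply [alpha p]: both sides become [mu * delta * alpha (Cconj p) w]. *)
  assert (Ephi : phi (automorphism lambda q w) = automorphism lambda q y).
  { rewrite Hphi by exact Hsw.
    rewrite <- (alpha_involutive p (automorphism lambda q y)) by assumption.
    f_equal. rewrite Aw, Ay, Ev. unfold elliptic.
    rewrite (alpha_involutive (Cconj p)).
    - ring.
    - exact Hp'.
    - apply in_disk_contract; [exact Hd|]. now apply in_disk_alpha. }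
  unfold wcomp. rewrite Hpsi by exact Hsw. rewrite Ephi. unfold kernel.
  rewrite Bw, By. unfold normalized_kernel.
  assert (N1 := one_plus_mult_conj_neq_0 p Hp).
  assert (N2 : 1 - lambda * Cconj p * Cconj p <> 0).
  { apply one_minus_neq_0; [|exact Hp']. now apply in_disk_unimodular. }
  field. repeat split; try assumption; now apply one_minus_neq_0.
Qed.
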